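(* Let $d\ge 1$ be a fixed integer. Then there exist constants $C$ and $n_0$ (depending only on $d$) such that for every integer $n\ge n_0$ there is a binary $(n,d)$-robust positioning sequence whose redundancy is at most $$3d\log_2 n+6.5\log_2 n+C .$$
   Context: For a binary sequence $s=s_0s_1\cdots s_{N-1}$ write $s[i,i+n-1]=s_is_{i+1}\cdots s_{i+n-1}$. The sequence $s$ is a binary $(n,d)$-robust positioning sequence (an $(n,d)$-RPS) if for all $0\le i<j\le N-n$ the Hamming distance between $s[i,i+n-1]$ and $s[j,j+n-1]$ is at least $d$. The redundancy of an $(n,d)$-RPS of length $N$ is $n-\log_2 N$. *)

(* Defs.v *)
From mathcomp Require Import all_boot all_order all_algebra.
From mathcomp Require Import reals exp.

Set Implicit Arguments.
Unset Strict Implicit.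
Unset Printing Implicit Defensive.

Local Open Scope ring_scope.

(* s[i, i + n - 1]; it has length n as soon as i + n <= size s. *)
Definition window (s : seq bool) (i n : nat) : seq bool := take n (drop i s).

(* [zip] truncates to the shorter argument, so this is the Hamming distance
   only for words of equal length. *)
Definition hamming (u v : seq bool) : nat :=
  count (fun p : bool * bool => p.1 != p.2) (zip u v).

(* The range j <= N - n, N = size s, is written j + n <= N because subtraction
   on nat is truncated. *)
Definition robust_positioning (n d : nat) (s : seq bool) : Prop :=
  forall i j : nat, (i < j)%N -> (j + n <= size s)%N ->
    (d <= hamming (window s i n) (window s j n))%N.

Definition log2 {R : realType} (x : R) : R := ln x / ln 2.

(* Meaningful for N > 0 only: [ln 0] is a default value. *)
Definition redundancy (R : realType) (n N : nat) : R := n%:R - log2 N%:R.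

(* Main.v *)
(** Rosenfeld's counting argument.  Let [A k] be the number of robust words of
    length [k].  A non-robust one-letter extension of a robust word of length
    [k] is determined by its prefix of length [j = k + 1 - n], the position
    [i < j] of a window close to the last one, and the set of fewer than [d]
    positions where the two windows differ, even if these windows overlap.
    Hence [2 A(k) <= A(k+1) + j V A(j)], where [V <= d n^d] counts these sets,
    and induction gives [A(k+1) >= (2 - 1/n) A(k)] as long as
    [n j V <= 2^(n-2)].  So there are robust words of length at least
    [2^n / (4 d n^(d+1))], whose redundancy is at most
    [(d + 1) log2 n + log2 (4 d)]. *)
Require Import Defs.
From mathcomp Require Import all_boot all_order all_algebra.
From mathcomp Require Import reals exp.
From mathcomp Require Import lra zify.

Local Open Scope ring_scope.

Import Order.TTheory GRing.Theory Num.Theory.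

(** A set rather than a cardinality: the counting argument recovers a bad word from this set. *)
Definition mismatches (n : nat) (s : seq bool) (i j : nat) : {set 'I_n} :=
  [set t : 'I_n | nth false s (i + t) != nth false s (j + t)].

Definition robustb (n d : nat) (s : seq bool) : bool :=
  [forall j : 'I_(size s).+1, forall i : 'I_j,
    (j + n <= size s)%N ==> (d <= #|mismatches n s i j|)%N].

Definition robust_words (n d k : nat) : {set k.-tuple bool} :=
  [set s : k.-tuple bool | robustb n d s].

Definition small_sets (n d : nat) : {set {set 'I_n}} :=
  [set A : {set 'I_n} | (#|A| < d)%N].

(** Both windows lie inside [s], so each has full length [n] and [zip] truncates nothing. *)
Lemma hamming_window n s i j : (i <= j)%N -> (j + n <= size s)%N ->
  hamming (window s i n) (window s j n) = #|mismatches n s i j|.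
Proof.
move=> ij jn; have size_window k : (k <= j)%N -> size (window s k n) = n.
  by move=> kj; rewrite size_takel // size_drop; lia.
rewrite /hamming -sum1_count (big_nth (false, false)) size_zip !size_window //.
rewrite minnn big_mkord -sum1_card; apply: eq_bigl => t.
rewrite nth_zip ?size_window // inE /window !nth_take //.
by rewrite !nth_drop.
Qed.

Lemma robustbP n d s :
  reflect (forall i j, (i < j)%N -> (j + n <= size s)%N ->
             (d <= #|mismatches n s i j|)%N)
          (robustb n d s).
Proof.
apply: (iffP forallP) => [H i j ij jn|H j].
  have js : (j < (size s).+1)%N by lia.
  by move/forallP/(_ (Ordinal ij))/implyP: (H (Ordinal js)); apply.
by apply/forallP => i; apply/implyP; apply: H.
Qed.

Lemma robustb_robust_positioning n d s :
  robustb n d s -> robust_positioning n d s.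
Proof.
by move/robustbP=> H i j ij jn; rewrite hamming_window ?H // ltnW.
Qed.

Lemma card_small_sets n d : (0 < n)%N -> (#|small_sets n d| <= d * n ^ d)%N.
Proof.
move=> n0; elim: d => [|d IH].
  by rewrite leqn0 cards_eq0; apply/eqP/setP => A; rewrite !inE.
have -> : small_sets n d.+1 = small_sets n d :|: [set A : {set 'I_n} | #|A| == d].
  by apply/setP => A; rewrite !inE ltnS leq_eqVlt orbC.
apply: leq_trans (leq_card_setU _ _) _; rewrite card_draws card_ord.
have bin_le : ('C(n, d) <= n ^ d)%N.
  apply: (@leq_trans (n ^_ d)); first by rewrite -bin_ffact leq_pmulr ?fact_gt0.
  rewrite ffact_prod -[X in (_ <= _ ^ X)%N]card_ord -prod_nat_const.
  by apply: leq_prod => i _; apply: leq_subr.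
apply: leq_trans (leq_add IH bin_le) _.
by rewrite addnC -mulSn leq_mul2l leq_pexp2l ?leqnSn ?orbT.
Qed.

Lemma card_bigcup_leq (T : finType) (j c : nat) (B : 'I_j -> {set T}) :
  (forall i, #|B i| <= c)%N -> (#|\bigcup_i B i| <= j * c)%N.
Proof.
move=> Bc; rewrite -[j in (j * _)%N]card_ord -sum_nat_const.
elim/big_rec2: _ => [|i m A _ Am]; first by rewrite cards0.
exact: leq_trans (leq_card_setU _ _) (leq_add (Bc i) Am).
Qed.

(* The letter at position [j + t] is recovered from the one at position
   [i + t < j + t]. *)
Lemma card_close_windows n d k i j : (i < j)%N -> (j + n = k)%N ->
  (#|[set s : k.-tuple bool |
       robustb n d (take j s) && (#|mismatches n s i j| < d)]|
     <= #|robust_words n d j| * #|small_sets n d|)%N.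
Proof.
move=> ij jnk; rewrite -cardsX.
pose f (s : k.-tuple bool) :=
  ([tuple nth false s t | t < j], mismatches n s i j).
have take_f (s : k.-tuple bool) : (f s).1 = take j s :> seq bool.
  apply: (@eq_from_nth _ false) => [|t].
    by rewrite size_tuple size_takel // size_tuple; lia.
  rewrite size_tuple => tj.
  by rewrite nth_take // (nth_mktuple _ _ (Ordinal tj)).
rewrite -(card_in_imset (f := f)); last first.
  move=> s s' _ _ ff; apply/val_inj/(@eq_from_nth _ false) => [|p].
    by rewrite !size_tuple.
  rewrite size_tuple; elim/ltn_ind: p => p IH pk.
  have [pj|jp] := ltnP p j.
    by rewrite -(nth_take _ pj s) -(nth_take _ pj s') -!take_f ff.
  have pn : (p - j < n)%N by lia.
  have /setP/(_ (Ordinal pn)) : (f s).2 = (f s').2 by rewrite ff.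
  rewrite !inE /= subnKC // IH; [|lia..].
  by case: (nth _ s p); case: (nth _ s' p); case: (nth _ s' _).
apply/subset_leq_card/subsetP => _ /imsetP[s + ->].
by rewrite !inE take_f /= => /andP[-> ->].
Qed.

Lemma robust_words_rec n d k : (0 < n)%N ->
  (2 * #|robust_words n d k| <=
   #|robust_words n d k.+1|
     + (k.+1 - n) * (#|robust_words n d (k.+1 - n)| * #|small_sets n d|))%N.
Proof.
move=> n0; pose ext := [set s : k.+1.-tuple bool | robustb n d (take k s)].
have card_ext : (2 * #|robust_words n d k| <= #|ext|)%N.
  pose f (p : k.-tuple bool * bool) := [tuple of rcons p.1 p.2].
  have f_inj : injective f.
    by move=> [s b] [s' b'] /(congr1 val) /rcons_inj[/val_inj -> ->].
  have -> : (2 * #|robust_words n d k|)%N =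
            #|f @: setX (robust_words n d k) [set: bool]|.
    by rewrite card_imset // cardsX cardsT card_bool mulnC.
  apply/subset_leq_card/subsetP => _ /imsetP[[s b] + ->].
  by rewrite !inE andbT /= -cats1 take_size_cat ?size_tuple.
apply: leq_trans card_ext _; set j := (k.+1 - n)%N.
pose B (i : 'I_j) := [set s : k.+1.-tuple bool |
       robustb n d (take j s) && (#|mismatches n s i j| < d)%N].
apply: (@leq_trans #|robust_words n d k.+1 :|: \bigcup_i B i|); last first.
  apply: leq_trans (leq_card_setU _ _) _; rewrite leq_add2l.
  apply: card_bigcup_leq => i; apply: card_close_windows => //.
  by rewrite /j; have := ltn_ord i; rewrite /j; lia.
apply/subset_leq_card/subsetP => s; rewrite !inE => /robustbP sk.
apply/orP; have [|/existsPn nB] := boolP [exists i, s \in B i].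
  by case/existsP=> i si; right; apply/bigcupP; exists i.
left; apply/robustbP => i j' ij'; rewrite size_tuple => j'n.
have mismatches_take l i1 j1 : (l <= k.+1)%N -> (i1 < j1)%N ->
    (j1 + n <= l)%N -> mismatches n (take l s) i1 j1 = mismatches n s i1 j1.
  move=> lk ij1 jl; apply/setP => t; rewrite !inE.
  by rewrite !nth_take //; have := ltn_ord t; lia.
have take_size l : (l <= k.+1)%N -> size (take l s) = l.
  by move=> lk; rewrite size_takel ?size_tuple.
have [j'k|kj'] := leqP (j' + n) k.
  by rewrite -(mismatches_take k) //; apply: sk => //; rewrite take_size.
(* The prefix of length [k] is robust, so a new close pair can only involve the window ending at the
   last letter. *)
have ej : j' = j by rewrite /j; lia.
move: ij' j'n; rewrite ej => ij jn.
(* Avoiding [B i] means that the two windows are far apart or that the prefix of length [j] is not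
   robust. The latter contradicts the robustness of the longer prefix of length [k]. *)
have := nB (Ordinal ij); rewrite !inE /= negb_and -leqNgt.
case/orP=> // /robustbP[] i1 j1 ij1; rewrite take_size; last lia.
move=> j1n; rewrite mismatches_take //; last lia.
by rewrite -(mismatches_take k) //; [apply: sk => //; rewrite take_size|]; lia.
Qed.

(** Strong induction: chaining the growth over the [n.-1] steps before [k] bounds [x (k.+1 - n)] by
    [x k / b ^+ n.-1]. The hypothesis on [q * v] then bounds the subtracted term by
    [(2 - b) * x k]. *)
Lemma rosenfeld_growth (F : realFieldType) (x : nat -> F) (v b : F)
    (n q : nat) :
    (0 < n)%N -> (forall k, 0 <= x k) -> 0 <= v -> 0 <= b <= 2 ->
    q%:R * v <= (2 - b) * b ^+ n.-1 ->
    (forall k, 2 * x k <= x k.+1 + (k.+1 - n)%:R * (x (k.+1 - n)%N * v)) ->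
  forall k, (k.+1 - n <= q)%N -> b * x k <= x k.+1.
Proof.
move=> n0 x0 v0 /andP[b0 b2] qv rec; elim/ltn_ind=> k IH kq.
suff bad : (k.+1 - n)%:R * (x (k.+1 - n)%N * v) <= (2 - b) * x k.
  by have := rec k; rewrite mulrBl in bad; lra.
(* For short words the truncated difference is 0 and nothing is subtracted. *)
have [kn|nk] := leqP k.+1 n.
  have -> : (k.+1 - n = 0)%N by lia.
  by rewrite mul0r mulr_ge0 // subr_ge0.
have chain m : (m <= k)%N -> b ^+ m * x (k - m)%N <= x k.
  elim: m => [|m IHm] mk; first by rewrite expr0 mul1r subn0.
  apply: le_trans (IHm (ltnW mk)); rewrite exprSr -mulrA.
  rewrite ler_wpM2l ?exprn_ge0 //.
  have -> : (k - m = (k - m.+1).+1)%N by lia.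
  by apply: IH; lia.
apply: le_trans (ler_wpM2l _ (chain n.-1 _)); [|by rewrite subr_ge0|lia].
have -> : (k - n.-1 = k.+1 - n)%N by lia.
rewrite [x _ * v]mulrC !mulrA.
apply: ler_wpM2r => //; apply: le_trans qv.
by rewrite ler_wpM2r // ler_nat.
Qed.

(** With [n = m.+2] and [b = 2 - 1/n], this bounds [(2 - b) * b ^+ n.-1] from below by
    [2 ^+ (n - 2) / n]. By Bernoulli, [(1 - 1/(2n)) ^+ n.-1] is at least [1 - (n - 1)/(2n)], hence
    at least 1/2. *)
Lemma bernoulli_half (F : realFieldType) (m : nat) :
  2 ^+ m / m.+2%:R <= (m.+2%:R^-1) * (2 - m.+2%:R^-1) ^+ m.+1 :> F.
Proof.
set y : F := m.+2%:R^-1.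
have y0 : 0 < y by rewrite invr_gt0 ltr0n.
have ym : m.+2%:R * y = 1 by rewrite mulfV // pnatr_eq0.
have y1 : y <= 1 by rewrite invf_le1 ?ltr0n // ler1n.
have bern l : 1 - l%:R * (y / 2) <= (1 - y / 2) ^+ l.
  elim: l => [|l IH]; first by rewrite mul0r subr0 expr0.
  have h : 0 <= 1 - y / 2 by lra.
  have := ler_wpM2l h IH; rewrite exprS; apply: le_trans.
  have ly : 0 <= l%:R * (y * y) by rewrite !mulr_ge0 ?ler0n // ltW.
  by rewrite -natr1; lra.
rewrite mulrC ler_pM2l //.
have -> : 2 - y = 2 * (1 - y / 2) by lra.
rewrite exprMn exprSr -mulrA ler_peMr ?exprn_ge0 //.
by have := bern m.+1; move: ym; rewrite -(natr1 m.+1); lra.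
Qed.

Lemma exists_robust_word n d q : (1 < n)%N ->
  (q * (n * #|small_sets n d|) <= 2 ^ (n - 2))%N ->
  exists2 s : seq bool, size s = q.+1 & robust_positioning n d s.
Proof.
case: n => [|[|m]] // _; rewrite !subSS subn0 => qV.
pose x k : rat := #|robust_words m.+2 d k|%:R.
pose b : rat := 2 - m.+2%:R^-1.
have b0 : 0 < b <= 2.
  rewrite subr_gt0 gerBl invr_ge0 ler0n andbT.
  by rewrite (@le_lt_trans _ _ 1) // invf_le1 ?ltr0n // ler1n.
have growth k : (k.+1 - m.+2 <= q)%N -> b * x k <= x k.+1.
  apply: (rosenfeld_growth _ x #|small_sets m.+2 d|%:R) => //.
  - by case/andP: b0 => /ltW -> ->.
  - have -> : 2 - b = m.+2%:R^-1 by rewrite subKr.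
    apply: le_trans (bernoulli_half _ m).
    by rewrite ler_pdivlMr ?ltr0n // -!natrM -natrX ler_nat -mulnA (mulnC _ m.+2).
  - by move=> l; rewrite -!natrM -natrD ler_nat robust_words_rec.
have pos k : (k <= q.+1)%N -> 0 < x k.
  elim: k => [_|k IH kq].
    (* The empty word is vacuously robust, as windows have positive length. *)
    rewrite ltr0n card_gt0; apply/set0Pn; exists [tuple].
    by rewrite inE; apply/robustbP => i j _; rewrite addnS.
  apply: lt_le_trans (growth k _); last by lia.
  by rewrite mulr_gt0 ?IH ?(ltnW kq) //; case/andP: b0.
have := pos q.+1 (leqnn _); rewrite ltr0n card_gt0 => /set0Pn[s].
rewrite inE => /robustb_robust_positioning sr.
by exists s => //; rewrite size_tuple.
Qed.

Theorem corollary3p12 (R : realType) (d : nat) (hd : (1 <= d)%N) :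
  exists (C : R) (n0 : nat), forall n : nat, (n0 <= n)%N ->
    exists s : seq bool,
      [/\ (0 < size s)%N,
          robust_positioning n d s
        & redundancy R n (size s)
            <= 3 * d%:R * log2 n%:R + 13 / 2 * log2 n%:R + C].
Proof.
(* In [C], the 4 comes from [2 ^ (n - 2)] and the [d] from [card_small_sets]. *)
exists (log2 (4 * d)%:R), 2%N => n n2.
pose D := (n * (d * n ^ d))%N; pose q := (2 ^ (n - 2) %/ D)%N.
have D0 : (0 < D)%N by rewrite !muln_gt0 expn_gt0 hd; lia.
have [|s sq rs] := exists_robust_word n d q n2.
  apply: leq_trans (leq_divM _ D); rewrite leq_mul2l leq_mul2l.
  by rewrite card_small_sets ?orbT //; lia.
exists s; split => //; first by rewrite sq.
(* The length [q.+1] exceeds the exact quotient of [2 ^ (n - 2)] by [D], so rounding down in [q]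
   costs nothing. *)
have size_lb : (2 ^ n <= 4 * d * n ^ d.+1 * size s)%N.
  have := ltn_ceil (2 ^ (n - 2)) D0; rewrite -/q -sq => /ltnW.
  rewrite -(leq_pmul2l (isT : 0 < 4)%N) -[X in (X * _ <= _)%N]/(2 ^ 2)%N.
  by rewrite -expnD subnKC // /D expnS; nia.
have ln2 : 0 < ln 2 :> R by rewrite ln_gt0 // ltr1n.
have ln_n : 0 <= log2 n%:R :> R.
  by rewrite divr_ge0 ?ln_ge0 // ?(ltW ln2) // ler1n; lia.
have log2M (a b : nat) : (0 < a)%N -> (0 < b)%N ->
    log2 (a * b)%:R = log2 a%:R + log2 b%:R :> R.
  by move=> a0 b0; rewrite /log2 natrM lnM ?posrE ?ltr0n // mulrDl.
have log2X (a k : nat) : (0 < a)%N -> log2 (a ^ k)%:R = k%:R * log2 a%:R :> R.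
  by move=> a0; rewrite mulr_natl /log2 natrX lnXn ?ltr0n // mulrnAl.
have n0 : (0 < n)%N by lia.
have : log2 (2 ^ n)%:R <= log2 (4 * d * n ^ d.+1 * size s)%:R :> R.
  rewrite /log2 ler_pM2r ?invr_gt0 // ler_ln ?posrE ?ltr0n ?expn_gt0 ?ler_nat //.
  by rewrite !muln_gt0 hd expn_gt0 n0 sq.
rewrite log2X // log2M ?muln_gt0 ?expn_gt0 ?hd ?n0 ?sq // log2M //; last first.
- by rewrite expn_gt0 n0.
- by rewrite muln_gt0.
rewrite log2X // /redundancy [log2 2]divff ?gt_eqF // mulr1 -natr1.
(* The bound obtained is [(d + 1) * log2 n + C]; the slack [(2 * d + 11/2) * log2 n] is
   nonnegative. *)
have d0 : 0 <= d%:R * log2 n%:R :> R by rewrite mulr_ge0.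
by lra.
Qed.
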